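(* Let $K$ be a genus-one knot with Seifert matrix $M=\begin{pmatrix} a_{11} & a_{12}\\ a_{21} & a_{22}\end{pmatrix}$ in the canonical band basis of a genus-one Seifert surface presented as a disk with two bands, and, for an integer $\ell\neq 0$, let $K(\ell,0)$ be the knot obtained by adding $2\ell$ twists to the first band. Then $K$ and $K(\ell,0)$ are $\Lambda_1$-equivalent if and only if $a_{22}=0$ and $(a_{12}+a_{21})\mid \ell$.
   Context: Band presentation: a genus-one knot $K\subset S^3$ bounds a minimal genus Seifert surface $F$ which is a disk with two bands attached along interleaved feet (so that $\partial F=K$ is connected); the bands may be knotted, twisted and linked with each other. The left band is the first band and the other one is the second band. Let $\alpha_1,\alpha_2$ be the closed curves running through the disk and once through the first, respectively second, band, oriented counterclockwise; they form the canonical band basis of $H_1(F)$. The Seifert matrix $M=(a_{ij})$ is the integral matrix of linking numbers of $\alpha_i$ with push-offs of $\alpha_j$ from $F$; it satisfies $|a_{12}-a_{21}|=1$. Twist operation: for $\ell\in\mathbb{Z}$, $K(\ell,0)$ is the boundary of the surface obtained from $F$ by cutting out an untwisted part of the first band and inserting $2\ell$ half twists (i.e. $|\ell|$ full twists) there. The inserted crossings are positive for $\ell>0$ and negative for $\ell<0$, with respect to the orientation of the knot as boundary of the surface. $K(\ell,0)$ has in the corresponding band basis the Seifert matrix $M'=\begin{pmatrix} a_{11}-\ell & a_{12}\\ a_{21} & a_{22}\end{pmatrix}$. $\Lambda_1$-equivalence: $K$ and $K(\ell,0)$ are called $\Lambda_1$-equivalent if the matrices $M$ and $M'$ are $\Lambda_1$-equivalent,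 i.e. there is $T\in GL_2(\mathbb{Z})$ with $TMT^{t}=M'$. *)

(* Defs.v *)
From Stdlib Require Import Relation_Operators.
From mathcomp Require Import all_boot all_order all_algebra.

Set Implicit Arguments.
Unset Strict Implicit.
Unset Printing Implicit Defensive.

Import Order.TTheory GRing.Theory Num.Theory.

(* Oriented links in S^3 are represented by planar diagrams in Morse position,
   read from bottom to top as a word of elementary slices.  A horizontal level
   is the left-to-right list of the strands that it meets; each strand carries
   a component label and a direction ([true] = upwards). *)
Definition strand (I : Type) := (I * bool)%type.
Definition opp (I : Type) (s : strand I) : strand I := (s.1, ~~ s.2).

(* Positions count strands from the left, starting from 0.
   [Cup k s] creates the strands s, opp s at positions k, k+1;
   [Cap k] joins the strands at k, k+1;
   [Cross k b] exchanges the strands at k, k+1, and the one that goes from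
   bottom left to top right is the overpass iff b. *)
Inductive slice (I : Type) : Type :=
| Cup of nat & strand I
| Cap of nat
| Cross of nat & bool.
Arguments Cap {I} k : rename.
Arguments Cross {I} k b : rename.

Definition diagram (I : Type) := seq (slice I).

Section Diagrams.
Variable I : eqType.
Implicit Types (st : seq (strand I)) (w : diagram I).

Definition step st (s : slice I) : option (seq (strand I)) :=
  match s with
  | Cup k x =>
      if k <= size st then Some (take k st ++ [:: x, opp x & drop k st])
      else None
  | Cap k =>
      if drop k st is [:: x, y & r] then
        if y == opp x then Some (take k st ++ r) else None
      else None
  | Cross k _ =>
      if drop k st is [:: x, y & r] then Some (take k st ++ [:: y, x & r])
      else None
  end.

Fixpoint run st w : option (seq (strand I)) :=
  if w is s :: w' then obind (run ^~ w') (step st s) else Some st.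

Definition closed_diagram w : bool := run [::] w == Some [::].

Local Open Scope ring_scope.

Definition crossing_sign (b : bool) (x y : strand I) : int :=
  if b (+) x.2 (+) y.2 then 1 else -1.

Definition slice_linking (a c : I) st (s : slice I) : int :=
  if s is Cross k b then
    if drop k st is [:: x, y & _] then
      let over := if b then x else y in
      let under := if b then y else x in
      if (over.1 == a) && (under.1 == c) then crossing_sign b x y else 0
    else 0
  else 0.

Fixpoint linking_from (a c : I) st w : int :=
  if w is s :: w' then
    slice_linking a c st s +
    (if step st s is Some st' then linking_from a c st' w' else 0)
  else 0.

(* The linking number of the components labelled a != c: the sum of the signs
   of the crossings at which a passes over c. *)
Definition linking_number (a c : I) w : int := linking_from a c [::] w.

End Diagrams.

Definition position (I : Type) (s : slice I) : nat :=
  match s with Cup k _ => k | Cap k => k | Cross k _ => k end.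
Definition inputs (I : Type) (s : slice I) : nat :=
  if s is Cup _ _ then 0 else 2.
Definition outputs (I : Type) (s : slice I) : nat :=
  if s is Cap _ then 0 else 2.
Definition place (I : Type) (j : nat) (s : slice I) : slice I :=
  match s with
  | Cup _ x => Cup j x
  | Cap _ => Cap j
  | Cross _ b => Cross j b
  end.

(* The Reidemeister moves, together with the planar isotopies between diagrams
   in Morse position (Freyd-Yetter, Turaev).  In [move_R3] the over/under data
   of the three strands must not be cyclic. *)
Inductive move (I : Type) : diagram I -> diagram I -> Prop :=
| move_far s t j of position s + inputs s <= j :
    move [:: s; place (j - inputs s + outputs s) t] [:: place j t; s]
| move_zigzag_l k x : move [:: Cup k x; Cap k.+1] [::]
| move_zigzag_r k x : move [:: Cup k.+1 x; Cap k] [::]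
| move_slide_cup k x b :
    move [:: Cup k x; Cross k.+1 b] [:: Cup k.+1 x; Cross k (~~ b)]
| move_slide_cap k b :
    move [:: Cross k.+1 b; Cap k] [:: Cross k (~~ b); Cap k.+1]
| move_R1_cup k x b : move [:: Cup k x; Cross k b] [:: Cup k (opp x)]
| move_R1_cap k b : move [:: Cross k b; Cap k] [:: Cap k]
| move_R2 k b : move [:: Cross k b; Cross k (~~ b)] [::]
| move_R3 k a b c of ~~ ((a == c) && (a != b)) :
    move [:: Cross k a; Cross k.+1 b; Cross k c]
         [:: Cross k.+1 c; Cross k b; Cross k.+1 a].

Inductive local_move (I : eqType) (w w' : diagram I) : Prop :=
| LocalMove w1 u v w2 of
    w = w1 ++ u ++ w2 & w' = w1 ++ v ++ w2 & move u v
    & closed_diagram w & closed_diagram w'.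

Definition isotopic (I : eqType) : diagram I -> diagram I -> Prop :=
  clos_refl_sym_trans (diagram I) (@local_move I).

Definition relabel (I J : Type) (f : I -> J) (w : diagram I) : diagram J :=
  map (fun s => match s with
    | Cup k x => Cup k (f x.1, x.2)
    | Cap k => Cap k
    | Cross k b => Cross k b
    end) w.

Definition cup_labels (I : Type) (w : diagram I) : seq I :=
  pmap (fun s => if s is Cup _ x then Some x.1 else None) w.

(* A knot is a nonempty link with one component, i.e. such that every
   2-colouring of its components is constant. *)
Definition knot (w : diagram unit) : Prop :=
  [/\ closed_diagram w, w <> [::] &
      forall w' : diagram bool, closed_diagram w' ->
        relabel (fun=> tt) w' = w -> constant (cup_labels w')].

(* A disk with bands is drawn with the disk at the bottom, with the feet of the
   bands on its upper side, and with the cores of the bands as a tangle diagram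
   above it.  Strands are cores of bands, labelled by the band, and the bands
   lie flat in the plane of projection, always with the same side in front,
   except at [FullTwist k b], a full twist (two half twists) of the band at
   position k, whose two crossings have the over/under data b. *)
Inductive band_slice : Type :=
| Flat of slice nat
| FullTwist of nat & bool.

Definition bands := seq band_slice.

Definition band_step (st : seq (strand nat)) (s : band_slice) :=
  match s with
  | Flat s => step st s
  | FullTwist k _ => if k < size st then Some st else None
  end.

Fixpoint band_run (st : seq (strand nat)) (F : bands) :=
  if F is s :: F' then obind (band_run ^~ F') (band_step st s) else Some st.

Definition bands_on (feet : seq (strand nat)) (F : bands) : bool :=
  band_run feet F == Some [::].

(* Replacing every strand s by the two parallel strands dbl s, listed from left
   to right and running in the band. *)
Section Double.
Variables (J : Type) (dbl : strand nat -> strand J * strand J).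

Definition double_slice (s : band_slice) : diagram J :=
  match s with
  | Flat (Cup k x) => [:: Cup k.*2 (dbl x).1; Cup k.*2.+1 (dbl x).2]
  | Flat (Cap k) => [:: Cap k.*2.+1; Cap k.*2]
  | Flat (Cross k b) =>
      [:: Cross k.*2.+1 b; Cross k.*2 b; Cross k.*2.+2 b; Cross k.*2.+1 b]
  | FullTwist k b => [:: Cross k.*2 b; Cross k.*2 b]
  end.

Definition double (F : bands) : diagram J := flatten (map double_slice F).

End Double.

(* The boundary is oriented so that the surface lies on its left when seen from
   the front: the left edge of a vertical band goes down, the right one up. *)
Definition edges (x : strand nat) : strand unit * strand unit :=
  ((tt, false), (tt, true)).

(* The part of the boundary of the disk off n feet. *)
Definition disk_boundary (n : nat) : diagram unit :=
  if n is m.+1 then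
    Cup 0 (tt, false) :: [seq Cup i.*2.+1 (tt, true) | i <- iota 0 m]
  else [:: Cup 0 (tt, false); Cap 0].

Definition boundary (feet : seq (strand nat)) (F : bands) : diagram unit :=
  disk_boundary (size feet) ++ double edges F.

(* Every compact connected orientable surface of genus g with connected boundary
   is a disk with 2g bands, hence with 4g feet. *)
Definition bounds_genus (K : diagram unit) (g : nat) : Prop :=
  exists feet F, [/\ bands_on feet F, size feet = 4 * g &
                     isotopic (boundary feet F) K].

Definition has_genus (K : diagram unit) (g : nat) : Prop :=
  bounds_genus K g /\ forall h, bounds_genus K h -> g <= h.

(* Two bands with interleaved feet: band 0 is the left one.  The curves alpha_i
   are oriented counterclockwise, hence go up at their right feet. *)
Definition band_feet : seq (strand nat) :=
  [:: (0, false); (1, false); (0, true); (1, true)].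

Definition two_bands (F : bands) : bool := bands_on band_feet F.

Definition band_boundary (F : bands) : diagram unit := boundary band_feet F.

(* In label (i, pushed), [pushed] tells alpha_i from its push-off alpha_i^+ to
   the front side of the surface; the latter is drawn displaced to its right. *)
Definition with_pushoff (x : strand nat) :
    strand (nat * bool) * strand (nat * bool) :=
  let core := ((x.1, false), x.2) in
  let push := ((x.1, true), x.2) in
  if x.2 then (core, push) else (push, core).

(* Inside the disk, the push-offs pass over the curves; the relative height of
   two curves, or of two push-offs, is irrelevant. *)
Definition curves_in_disk : diagram (nat * bool) :=
  [:: Cup 0 ((0, true), false); Cup 1 ((0, false), false);
      Cup 4 ((1, true), false); Cup 5 ((1, false), false);
      Cross 3 true; Cross 2 false; Cross 4 true; Cross 3 true].

(* The link formed by alpha_0, alpha_1 and their push-offs. *)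
Definition curves_link (F : bands) : diagram (nat * bool) :=
  curves_in_disk ++ double with_pushoff F.

Local Open Scope ring_scope.

Definition seifert_matrix (F : bands) : 'M[int]_2 :=
  \matrix_(i < 2, j < 2)
    linking_number ((i : nat), false) ((j : nat), true) (curves_link F).

(* The surface with boundary K(l,0): |l| full twists are inserted just above the
   left foot of the first band.  The edges of a band being antiparallel, the
   crossings of a twist are positive when b = false. *)
Definition add_twists (l : int) (F : bands) : bands :=
  nseq `|l|%N (FullTwist 0 (l < 0)) ++ F.

Definition Lambda1_equiv_mx (M M' : 'M[int]_2) : Prop :=
  exists2 T : 'M[int]_2, T \in unitmx & T *m M *m T^T = M'.

Definition Lambda1_equiv (F F' : bands) : Prop :=
  Lambda1_equiv_mx (seifert_matrix F) (seifert_matrix F').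

(* Main.v *)
Require Import Defs.
From mathcomp Require Import all_boot all_order all_algebra.
From mathcomp Require Import zify ring.

Set Implicit Arguments.
Unset Strict Implicit.
Unset Printing Implicit Defensive.

Import GRing.Theory Num.Theory.
Local Open Scope ring_scope.

(** Two facts about Seifert matrices are read off the diagrams: inserting twists
    subtracts [l] from the top left entry, and the off-diagonal entries differ
    by 1.  For the latter, the difference counts the signed crossings of the
    cores of the two bands, and so it is the total variation of the signed
    number of pairs (strand of band 0, strand of band 1 further right) between
    the feet, where it is 1, and the top, where it is 0.

    In a congruence T M T^t = M', comparing skew parts gives det T = 1, and then
    comparing determinants gives l a_22 = 0, so that a_22 = 0.  If T is not
    triangular, the symmetric parts force a_12 + a_21 = 0, which is impossible
    since this number is odd; if T is triangular, then the top left entry says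
    that a_12 + a_21 divides l. *)

(** * Integral congruences of 2 x 2 matrices *)

Lemma skew_congruence_shift (p q r t a b c d l : int) :
  l != 0 -> b != c -> b + c != 0 ->
  p * (p * a + q * c) + q * (p * b + q * d) = a - l ->
  r * (p * a + q * c) + t * (p * b + q * d) = b ->
  p * (r * a + t * c) + q * (r * b + t * d) = c ->
  r * (r * a + t * c) + t * (r * b + t * d) = d ->
  d = 0 /\ (b + c %| l)%Z.
Proof.
move=> l0 bc s0 e00 e01 e10 e11.
(* Here T has rows (p, q), (r, t) and M has rows (a, b), (c, d); [e01] minus [e10] reads det T (b -
   c) = b - c. *)
have det1 : p * t - q * r = 1.
  have /eqP : (p * t - q * r - 1) * (b - c) = 0 by lia.
  by rewrite mulf_eq0 [b - c == 0]subr_eq0 (negPf bc) orbF subr_eq0 => /eqP.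
have d0 : d = 0.
  have /eqP : l * d = 0.
    have : (p * t - q * r) ^+ 2 * (a * d - b * c) = (a - l) * d - b * c.
      transitivity ((p * (p * a + q * c) + q * (p * b + q * d)) *
          (r * (r * a + t * c) + t * (r * b + t * d)) -
          (r * (p * a + q * c) + t * (p * b + q * d)) *
          (p * (r * a + t * c) + q * (r * b + t * d))); first by ring.
      by rewrite e00 e01 e10 e11.
    by rewrite det1; lia.
  by rewrite mulf_eq0 (negPf l0) => /eqP.
split=> //; subst d.
have /eqP : r * (r * a + t * (b + c)) = 0 by lia.
rewrite mulf_eq0 => /orP[/eqP r0|/eqP rE].
  subst r; have pt : p * t = 1 by lia.
  have p2 : p * p = 1.
    have /eqP := congr1 absz pt; rewrite abszM muln_eq1 => /andP[/eqP p1 _].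
    by have [->|->] : p = 1 \/ p = -1 by lia.
  apply/dvdzP; exists (- (p * q)).
  have : p * p * a + p * q * (b + c) = a - l by lia.
  by rewrite p2; lia.
case/eqP: s0.
(* This is [e01] + [e10], arranged so that the factor vanishing by [rE] and det T appear; it yields
   -(b + c) = b + c. *)
have : p * (r * a + t * (b + c)) *+ 2 - (p * t - q * r) * (b + c) = b + c.
  by lia.
by rewrite rE det1; lia.
Qed.

Lemma mxcongruenceE (T M : 'M[int]_2) i j :
  (T *m M *m T^T) i j =
  T j 0 * (T i 0 * M 0 0 + T i 1 * M 1 0) +
  T j 1 * (T i 0 * M 0 1 + T i 1 * M 1 1).
Proof.
have lift00 : lift ord0 ord0 = 1 :> 'I_2 by apply: val_inj.
by rewrite !(mxE, big_ord_recl, big_ord0) lift00; ring.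
Qed.

Lemma I2_ind (P : 'I_2 -> Prop) : P 0 -> P 1 -> forall i, P i.
Proof.
move=> P0 P1 [[|[|//]] lti].
  by have -> : Ordinal lti = 0 by apply: val_inj.
by have -> : Ordinal lti = 1 by apply: val_inj.
Qed.

Lemma Lambda1_equiv_mx_twist (M M' : 'M[int]_2) (l : int) :
  M' = M - l *: delta_mx 0 0 -> l != 0 -> M 0 1 != M 1 0 ->
  M 0 1 + M 1 0 != 0 ->
  Lambda1_equiv_mx M M' <-> M 1 1 = 0 /\ ((M 0 1 + M 1 0)%R %| l)%Z.
Proof.
move=> -> l0 bc s0; split=> [[T _ /matrixP eqM]|[d0 /dvdzP[k lE]]].
  have eqM_entry i j := esym (etrans (esym (eqM i j)) (mxcongruenceE T M i j)).
  move: (eqM_entry 0 0) (eqM_entry 0 1) (eqM_entry 1 0) (eqM_entry 1 1).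
  rewrite !mxE /= !mulr0 mulr1 !subr0 => e00 e01 e10 e11.
  exact: skew_congruence_shift e00 e01 e10 e11.
(* As a_22 = 0, this transvection changes only the top left entry, by -k (a_12 + a_21) = -l. *)
pose T : 'M[int]_2 := 1%:M - k *: delta_mx 0 1.
exists T.
  have trigT : is_trig_mx T^T.
    by apply/is_trig_mxP; do 2!apply: I2_ind => //; rewrite !mxE /= mulr0 subr0.
  rewrite unitmxE -det_tr det_trig // big1 ?unitr1 //.
  by apply: I2_ind => _; rewrite !mxE /=; ring.
apply/matrixP; apply: I2_ind; apply: I2_ind;
  by rewrite mxcongruenceE !mxE lE /= d0; ring.
Qed.

(** * Independence of a slice from the strands to its left *)

Section Locality.
Variable I : eqType.
Implicit Types (st : seq (strand I)) (w : diagram I) (a c : I).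

Definition shift (m : nat) (s : slice I) : slice I := place (m + position s) s.

Lemma step_shift st0 st s :
  step (st0 ++ st) (shift (size st0) s) = omap (cat st0) (step st s).
Proof.
case: s => [k x|k|k b] /=; rewrite ?drop_cat ?take_cat ltnNge leq_addr addKn /=.
- by rewrite size_cat leq_add2l; case: ifP => //= _; rewrite -catA.
- by case: (drop k st) => [|x [|y r]] //=; case: ifP; rewrite //= catA.
- by case: (drop k st) => [|x [|y r]] //=; rewrite catA.
Qed.

Lemma slice_linking_shift a c st0 st s :
  slice_linking a c (st0 ++ st) (shift (size st0) s) = slice_linking a c st s.
Proof. by case: s => //= k b; rewrite drop_cat ltnNge leq_addr addKn. Qed.

Lemma run_shift st0 st w :
  run (st0 ++ st) (map (shift (size st0)) w) = omap (cat st0) (run st w).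
Proof. by elim: w st => //= s w IHw st; rewrite step_shift; case: (step st s). Qed.

Lemma linking_from_shift a c st0 st w :
  linking_from a c (st0 ++ st) (map (shift (size st0)) w) =
  linking_from a c st w.
Proof.
elim: w st => //= s w IHw st; rewrite slice_linking_shift step_shift.
by case: (step st s) => //= st'; rewrite IHw.
Qed.

Lemma run_cat st w1 w2 :
  run st (w1 ++ w2) = obind (fun st' => run st' w2) (run st w1).
Proof. by elim: w1 st => //= s w IHw st; case: (step st s) => /=. Qed.

Lemma linking_from_cat a c st w1 w2 :
  linking_from a c st (w1 ++ w2) =
  linking_from a c st w1 +
  (if run st w1 is Some st' then linking_from a c st' w2 else 0).
Proof.
elim: w1 st => [|s w IHw] st /=; first by rewrite add0r.
rewrite -addrA; case: (step st s) => [st'|] /=; last by rewrite addr0.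
by rewrite IHw.
Qed.

End Locality.

(** * Signed crossings of the band cores *)

Section Intersections.
Implicit Types (i j : nat) (x y : strand nat) (st : seq (strand nat)).

Definition signed_label i x : int := if x.1 == i then (-1) ^+ ~~ x.2 else 0.

Definition signed_count i st : int := \sum_(x <- st) signed_label i x.

(** A potential on levels: its drop across a slice is the contribution of that slice to lk(alpha_i,
    alpha_j^+) - lk(alpha_j, alpha_i^+). *)
Fixpoint signed_pairs i j st : int :=
  if st is x :: st' then
    signed_label i x * signed_count j st' + signed_pairs i j st'
  else 0.

Lemma signed_count_cat i st1 st2 :
  signed_count i (st1 ++ st2) = signed_count i st1 + signed_count i st2.
Proof. exact: big_cat. Qed.

Lemma signed_count_cons i x st :
  signed_count i (x :: st) = signed_label i x + signed_count i st.
Proof. exact: big_cons. Qed.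

Lemma signed_pairs_cat i j st1 st2 :
  signed_pairs i j (st1 ++ st2) =
  signed_pairs i j st1 + signed_pairs i j st2 +
  signed_count i st1 * signed_count j st2.
Proof.
elim: st1 => [|x st1 IH] /=; first by rewrite /signed_count big_nil; ring.
by rewrite IH signed_count_cat signed_count_cons; ring.
Qed.

Lemma signed_label_opp i x : signed_label i (Defs.opp x) = - signed_label i x.
Proof. by case: x => n [] /=; rewrite /signed_label /=; case: eqP. Qed.

(** Used for cups and caps: their two strands lie in one band and form no mixed pair. *)
Lemma signed_label_neq i j x : i != j -> signed_label i x * signed_label j x = 0.
Proof.
move=> /negPf ij; rewrite /signed_label; case: eqP => [->|_]; last exact: mul0r.
by rewrite ij mulr0.
Qed.

Definition pushed_levels st : seq (strand (nat * bool)) :=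
  flatten [seq [:: (with_pushoff x).1; (with_pushoff x).2] | x <- st].

Lemma pushed_levels_cat st1 st2 :
  pushed_levels (st1 ++ st2) = pushed_levels st1 ++ pushed_levels st2.
Proof. by rewrite /pushed_levels map_cat flatten_cat. Qed.

Lemma size_pushed_levels st : size (pushed_levels st) = (size st).*2.
Proof. by elim: st => //= x st ->. Qed.

Definition band_shift (m : nat) (s : band_slice) : band_slice :=
  match s with
  | Flat s => Flat (shift m s)
  | FullTwist k b => FullTwist (m + k) b
  end.

Lemma double_slice_shift (J : eqType) (dbl : strand nat -> strand J * strand J)
    (m : nat) (s : band_slice) :
  double_slice dbl (band_shift m s) = map (shift m.*2) (double_slice dbl s).
Proof. by case: s => [[k x|k|k b]|k b]; rewrite /= /shift /= !doubleD ?addnS. Qed.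

Lemma band_step_shift st0 st (s : band_slice) :
  band_step (st0 ++ st) (band_shift (size st0) s) =
  omap (cat st0) (band_step st s).
Proof.
case: s => [s|k b] /=; first exact: step_shift.
by rewrite size_cat ltn_add2l; case: ifP.
Qed.

(** Splitting off the strands left of the slice reduces every case analysis to position 0. *)
Lemma band_step_local st (s : band_slice) st' :
  band_step st s = Some st' ->
  exists st0 st1 st1', exists2 s0 : band_slice, s = band_shift (size st0) s0 &
    [/\ st = st0 ++ st1, st' = st0 ++ st1', band_step st1 s0 = Some st1' &
        match s0 with Flat s => position s | FullTwist k _ => k end = 0%N].
Proof.
pose k := match s with Flat s => position s | FullTwist k _ => k end.
pose s0 := match s with
  | Flat s => Flat (place 0 s) | FullTwist _ b => FullTwist 0 b end.
move=> stepE; have k_le : (k <= size st)%N.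
  move: stepE; rewrite leqNgt; apply: contraPN => lt_st_k.
  rewrite /k in lt_st_k *; case: s lt_st_k {k s0} => [[k x|k|k b]|k b] /= lt_st_k.
  - by rewrite leqNgt lt_st_k.
  - by rewrite drop_oversize // ltnW.
  - by rewrite drop_oversize // ltnW.
  - by rewrite ltnNge ltnW.
have sizek : size (take k st) = k by rewrite size_takel.
have sE : s = band_shift (size (take k st)) s0.
  rewrite sizek /s0 /k.
  by case: (s) => [[? ?|?|? ?]|? ?]; rewrite /= /shift /= addn0.
have s0_pos : match s0 with Flat s => position s | FullTwist k _ => k end = 0%N.
  by rewrite /s0; case: (s) => [[]|].
move: stepE; rewrite {1}sE -{1}(cat_take_drop k st) band_step_shift.
case stepE: (band_step _ s0) => [st1'|] //= [<-].
exists (take k st), (drop k st), st1', s0 => //; split=> //.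
by rewrite cat_take_drop.
Qed.

(** Only a crossing of band i with band j matters: there one core passes over the push-off of the
    other. The invariance of [signed_count j] controls the pairs whose left member lies left of the
    slice. *)
Lemma band_step_intersection i j st (s : band_slice) st' :
  i != j -> band_step st s = Some st' ->
  [/\ signed_count j st = signed_count j st',
      run (pushed_levels st) (double_slice with_pushoff s) =
        Some (pushed_levels st') &
      linking_from (i, false) (j, true) (pushed_levels st)
        (double_slice with_pushoff s) -
      linking_from (j, false) (i, true) (pushed_levels st)
        (double_slice with_pushoff s) =
      signed_pairs i j st - signed_pairs i j st'].
Proof.
move=> ij /band_step_local[st0 [st1 [st1' [s0 -> [-> -> stepE s0_pos]]]]].
suff [countE runE linkE] :
  [/\ signed_count j st1 = signed_count j st1',
      run (pushed_levels st1) (double_slice with_pushoff s0) =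
        Some (pushed_levels st1') &
      linking_from (i, false) (j, true) (pushed_levels st1)
        (double_slice with_pushoff s0) -
      linking_from (j, false) (i, true) (pushed_levels st1)
        (double_slice with_pushoff s0) =
      signed_pairs i j st1 - signed_pairs i j st1'].
  rewrite !pushed_levels_cat double_slice_shift -size_pushed_levels.
  rewrite run_shift runE !linking_from_shift linkE !signed_count_cat countE.
  by rewrite !signed_pairs_cat countE; split=> //; ring.
have ijx x := signed_label_neq x ij.
case: s0 stepE s0_pos => [[k x|k|k b]|k b] /= + k0; rewrite {k}k0 ?double0.
- rewrite !take0 !drop0 => -[<-].
  rewrite /= !signed_count_cons !signed_label_opp.
  split; first by ring.
    by case: x => n [] /=; rewrite ?take0 ?drop0.
  by rewrite mulrDr mulrN ijx; ring.
- case: st1 => [|x [|y r]]; rewrite ?drop0 ?take0 //=; case: eqP => // -> [<-].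
  rewrite /= !signed_count_cons !signed_label_opp.
  split; first by ring.
    by case: x => n [] /=; rewrite !eqxx /= ?drop0 ?take0 /= ?eqxx.
  rewrite mulrDr mulrN ijx.
  by case: (x) => n []; rewrite /= !eqxx /= ?drop0 ?take0 /= ?eqxx /=; ring.
- case: st1 => [|[m dx] [|[n dy] r]]; rewrite ?drop0 ?take0 //= => -[<-].
  rewrite /= !signed_count_cons; split; first by ring.
    by case: dx; case: dy; rewrite /= ?drop0 ?take0.
  (* Switching [b] changes both the crossing sign and the overpass, so the difference depends only
     on directions and left-right order, as [signed_pairs] does. *)
  rewrite /signed_label /=; case: dx; case: dy; case: b;
    rewrite /= ?drop0 ?take0 /= /crossing_sign !xpair_eqE /= ?andbT ?andbF;
    case: (m == i); case: (m == j); case: (n == i); case: (n == j);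
    by rewrite /=; ring.
- case: st1 => [|[n d] r] //= [<-].
  split=> //.
  (* A full twist crosses a curve only with its own push-off. *)
  have nij : (n == i) && (n == j) = false.
    by apply: contraNF ij => /andP[/eqP <- /eqP <-].
  have nji : (n == j) && (n == i) = false by rewrite andbC.
  case: d; case: b; rewrite /= ?drop0 ?take0 /= !xpair_eqE /= ?andbT ?andbF.
  all: by rewrite ?nij ?nji; ring.
Qed.

Lemma band_run_intersection i j st (F : bands) st' :
  i != j -> band_run st F = Some st' ->
  linking_from (i, false) (j, true) (pushed_levels st)
    (Defs.double with_pushoff F) -
  linking_from (j, false) (i, true) (pushed_levels st)
    (Defs.double with_pushoff F) =
  signed_pairs i j st - signed_pairs i j st'.
Proof.
move=> ij; elim: F st => [|s F IHF] st /= => [[<-]|]; first by rewrite !subrr.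
case stepE: (band_step st s) => [st1|] //= runE.
have [_ run_s link_s] := band_step_intersection ij stepE.
rewrite /Defs.double /= !linking_from_cat run_s -/(Defs.double with_pushoff F).
by move: link_s (IHF _ runE); lia.
Qed.

End Intersections.

(** * Entries of the Seifert matrix *)

Lemma curves_linkE a c (F : bands) :
  linking_number a c (curves_link F) =
  linking_from a c [::] curves_in_disk +
  linking_from a c (pushed_levels band_feet) (Defs.double with_pushoff F).
Proof. by rewrite /linking_number linking_from_cat. Qed.

Lemma seifert_matrix_skew (F : bands) :
  two_bands F -> seifert_matrix F 0 1 - seifert_matrix F 1 0 = 1.
Proof.
move=> /eqP hF; have := @band_run_intersection 0%N 1%N _ _ _ isT hF.
(* The interleaved feet contribute 1 - 1 from the left foot of band 0 and 1 from its right foot. *)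
have -> : signed_pairs 0 1 band_feet = 1.
  by rewrite /= !signed_count_cons /signed_count big_nil.
(* In the disk the push-offs lie on top, whereas the linking number counts curves passing over
   push-offs. *)
have disk01 : linking_from (0%N, false) (1%N, true) [::] curves_in_disk = 0.
  by vm_compute.
have disk10 : linking_from (1%N, false) (0%N, true) [::] curves_in_disk = 0.
  by vm_compute.
rewrite !mxE !curves_linkE (_ : nat_of_ord (1 : 'I_2) = 1%N) // disk01 disk10.
by rewrite !add0r subr0.
Qed.

(** At exactly one of the two crossings alpha_0 passes over its push-off. The two run in parallel,
    so the sign is opposite to that of the antiparallel edges. *)
Lemma linking_from_twist (i j : 'I_2) b :
  linking_from (i : nat, false) (j : nat, true) (pushed_levels band_feet)
    (Defs.double with_pushoff [:: FullTwist 0 b]) =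
  (if b then 1 else -1) *+ ((i == 0) && (j == 0)).
Proof. by case: b; elim/I2_ind: i; elim/I2_ind: j; vm_compute. Qed.

(** A full twist preserves the level, so contributions add up. *)
Lemma linking_from_twists a c (n : nat) b (F : bands) :
  linking_from a c (pushed_levels band_feet)
    (Defs.double with_pushoff (nseq n (FullTwist 0 b) ++ F)) =
  linking_from a c (pushed_levels band_feet)
    (Defs.double with_pushoff [:: FullTwist 0 b]) *+ n +
  linking_from a c (pushed_levels band_feet) (Defs.double with_pushoff F).
Proof.
elim: n => [|n IHn]; first by rewrite add0r.
rewrite mulrS -addrA -IHn -[nseq n.+1 _ ++ F]/([:: _] ++ (nseq n _ ++ F)).
by rewrite /Defs.double map_cat flatten_cat linking_from_cat.
Qed.

Lemma seifert_matrix_add_twists (l : int) (F : bands) :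
  seifert_matrix (add_twists l F) = seifert_matrix F - l *: delta_mx 0 0.
Proof.
apply/matrixP=> i j; rewrite !mxE !curves_linkE linking_from_twists.
rewrite linking_from_twist -mulrnA mulnC mulrnA mulr_natr [LHS]addrCA addrC.
congr (_ + _); rewrite -mulNrn; congr (_ *+ _).
(* |l| twists, each contributing minus the sign of l, sum to -l. *)
by case: ifP => l0; rewrite ?mulNrn natz; lia.
Qed.

Theorem theorem1p1 (K : diagram unit) (F : bands) (M : 'M[int]_2) (l : int)
    (hK : knot K) (gK : has_genus K 1%N)
    (hF : two_bands F) (KF : isotopic K (band_boundary F))
    (hM : M = seifert_matrix F) (hl : l != 0) :
  Lambda1_equiv F (add_twists l F) <->
  M 1 1 = 0 /\ ((M 0 1 + M 1 0)%R %| l)%Z.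
Proof.
have skew := seifert_matrix_skew hF; rewrite /Lambda1_equiv -hM in skew *.
apply: Lambda1_equiv_mx_twist => //; last by lia.
- by rewrite seifert_matrix_add_twists -hM.
- by lia.
Qed.
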